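(* For every $n\ge 2$, the graph $\mathcal{O}_n$ (i.e. its adjacency matrix $B(\mathcal{O}_n)$) has eigenvalues $\lambda^n_1,\dots,\lambda^n_n$, where $$\lambda_i^n=(-1)^{n+i}\,i ,\qquad 1\le i\le n,$$ and if $m_{n,i}$ denotes the multiplicity of $\lambda_i^n$, then $$m_{n,i}=\mathcal{E}_{n-1,i-1}.$$
   Context: For $n\ge2$, the odd graph $\mathcal{O}_n$ has as vertices the $(n-1)$-element subsets of $\{1,\dots,2n-1\}$ (written as increasing sequences), with an edge between two vertices iff they are disjoint. $B(\mathcal{O}_n)$ is its adjacency matrix, with entries considered in a field of characteristic $0$. $\mathcal{E}=\{\mathcal{E}_{n,k}\}_{n,k\ge0}$ (the Catalan triangle) is the lower triangular array defined by $\mathcal{E}_{0,0}=1$, $\mathcal{E}_{n,k}=0$ for $n<k$, and $\mathcal{E}_{n,k}=\mathcal{E}_{n-1,k-1}+2\mathcal{E}_{n-1,k}+\mathcal{E}_{n-1,k+1}$ for $n\ge1$, $k\ge0$, with the convention $\mathcal{E}_{n,-1}=0$. Its first rows are $(1)$, $(2,1)$, $(5,4,1)$, $(14,14,6,1)$. *)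

(* Defs.v *)
From HB Require Import structures.
From mathcomp Require Import all_boot all_order all_algebra.

Set Implicit Arguments.
Unset Strict Implicit.
Unset Printing Implicit Defensive.

Import GRing.Theory.
Local Open Scope ring_scope.

(* The ground set {1, ..., 2n-1} is represented by 'I_(2 * n - 1), that is by
   {0, ..., 2n-2}; subtraction on nat is truncated, which is harmless for
   n >= 1. *)
Definition odd_vertex (n : nat) : finType :=
  {A : {set 'I_(2 * n - 1)} | #|A| == (n - 1)%N}.

Definition odd_edge (n : nat) : rel (odd_vertex n) :=
  fun A B => [disjoint val A & val B].

(* The vertices index rows and columns through the enumeration of T. *)
Definition adjacency_mx (F : fieldType) (T : finType) (e : rel T) :
    'M[F]_#|T| :=
  \matrix_(i, j) (e (enum_val i) (enum_val j))%:R.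

Definition odd_adj (F : fieldType) (n : nat) : 'M[F]_#|odd_vertex n| :=
  adjacency_mx F (@odd_edge n).

Definition odd_lambda (F : fieldType) (n i : nat) : F :=
  (-1) ^+ (n + i) * i%:R.

(* The entry of index (n, k - 1) in the recurrence is 0 when k = 0.  The
   vanishing above the diagonal is not imposed: see catalan_triangle_gt. *)
Fixpoint catalan_triangle (n k : nat) : nat :=
  match n with
  | 0 => (k == 0)%N
  | m.+1 => ((if k is j.+1 then catalan_triangle m j else 0)
             + 2 * catalan_triangle m k + catalan_triangle m k.+1)%N
  end.

Lemma catalan_triangle_gt (n k : nat) :
  (n < k)%N -> catalan_triangle n k = 0%N.
Proof.
elim: n k => [|n IHn] [|k] //= lt_nk.
by rewrite !IHn // ltnW // ltnW.
Qed.

Example catalan_triangle_rows :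
  [seq [seq catalan_triangle n k | k <- iota 0 n.+1] | n <- iota 0 4]
  = [:: [:: 1]; [:: 2; 1]; [:: 5; 4; 1]; [:: 14; 14; 6; 1]]%N.
Proof. by []. Qed.

(* Main.v *)
Require Import Defs.
From HB Require Import structures.
From mathcomp Require Import all_boot all_order all_algebra.
From mathcomp Require Import zify.
Import GRing.Theory.
Local Open Scope ring_scope.

(** The odd graph O_n is the Kneser graph of the k-subsets of a set of N
    points, with k = n - 1 and N = 2 n - 1, and the whole spectrum of a Kneser
    graph can be read off from a triangular form of its adjacency matrix.

    For a set R with at most k points, let f_R be the indicator of the
    k-subsets that contain R, and let W_j be the span of the f_R with
    |R| <= j; in characteristic 0 it is already spanned by those with |R| = j.
    If |R| = j, then the adjacency matrix sends f_R to a function that vanishes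
    on the S that meet R and is 'C(N - k - j, k - j) on the others.  By inclusion-exclusion,
    the indicator of disjointness from R is the sum of (-1)^|Q| f_Q over the
    subsets Q of R.  Modulo W_(j-1) only Q = R remains, so the matrix acts on
    W_j / W_(j-1) as the scalar (-1)^j 'C(N - k - j, k - j)
    (kneser_filtration_tri).  For the odd graph these scalars are
    (-1)^j (n - j), and they are distinct in characteristic 0; hence the
    matrix is diagonalizable, and the multiplicity of the j-th scalar is
    dim W_j - dim W_(j-1), both geometrically (rank_filtration_step) and
    algebraically (mup_char_poly_diagonalizable).

    The same triangular form gives the dimensions.  On j-subsets, with
    2 j <= N, none of the scalars of its filtration is 0, so the disjointness
    matrix is invertible; it factors, up to a nonzero integer, through the
    inclusion matrix of j-subsets in k-subsets, whose rows span W_j.  Thus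
    dim W_j = 'C(N, j) (rank_kneser_filtration).

    Last, the entries of the Catalan triangle are differences of two
    consecutive binomial coefficients of odd order (catalan_triangle_bin),
    because both sides satisfy the recurrence obtained by applying Pascal's
    rule twice. *)

Set Implicit Arguments.
Unset Strict Implicit.
Unset Printing Implicit Defensive.

(** * Diagonalizable matrices *)

(** Stated as an intertwining relation, so that no inverse of P occurs:
    P (X - A) = (X - B) P, and det P can be cancelled. *)
Lemma char_poly_similar (F : fieldType) (d : nat) (P A B : 'M[F]_d) :
  P \in unitmx -> P *m A = B *m P -> char_poly A = char_poly B.
Proof.
move=> P_unit PA.
have detP0 : \det (map_mx polyC P) != 0.
  by rewrite det_map_mx polyC_eq0 -unitfE -unitmxE.
apply: (mulfI detP0); rewrite [RHS]mulrC /char_poly -!det_mulmx; congr (\det _).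
rewrite /char_poly_mx mulmxBr mulmxBl -!map_mxM PA.
by rewrite mul_mx_scalar mul_scalar_mx.
Qed.

Lemma rank_diag_mx (F : fieldType) (d : nat) (v : 'rV[F]_d) :
  \rank (diag_mx v) = #|[pred i | v 0 i != 0]|.
Proof.
pose P := [pred i | v 0 i != 0].
have -> : (diag_mx v :=: \sum_(i | P i) <<'e_i : 'rV[F]_d>>)%MS.
  apply/eqmxP/andP; split.
    apply/row_subP => i; rewrite row_diag_mx.
    have [->|v_i0] := eqVneq (v 0 i) 0; first by rewrite scale0r sub0mx.
    by rewrite scalemx_sub // (sumsmx_sup i) // genmxE.
  apply/sumsmx_subP => i v_i0; rewrite genmxE.
  rewrite -[X in (X <= _)%MS]scale1r -(mulVf v_i0) -scalerA -row_diag_mx.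
  by rewrite scalemx_sub // row_sub.
have /mxdirectP /= -> := @mxdirect_delta F _ P d id (in2W (@inj_id _)).
rewrite -sum1_card; apply: eq_bigr => i _.
by rewrite mxrank_gen mxrank_delta.
Qed.

(** Both sides count the occurrences of a on the diagonal of a diagonal form
    of A. *)
Lemma mup_char_poly_diagonalizable (F : fieldType) (d : nat) (A : 'M[F]_d)
    (a : F) :
  diagonalizable A -> mup a (char_poly A) = \rank (eigenspace A a).
Proof.
case=> P P_unit /similar_diagPex[v /(similarLR P_unit) defA].
have PA : P *m A = diag_mx v *m P.
  by rewrite defA conjVmx // !mulmxA mulmxV // mul1mx.
rewrite (char_poly_similar P_unit PA) char_poly_trig ?diag_mx_is_trig //.
have -> : \prod_(i < d) ('X - (diag_mx v i i)%:P)
          = \prod_(y <- [seq v 0 i | i <- enum 'I_d]) ('X - y%:P).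
  rewrite big_map big_enum /=; apply: eq_bigr => i _.
  by rewrite mxE eqxx mulr1n.
rewrite mu_prod_XsubC count_map.
have rank_shift : \rank (A - a%:M) = \rank (diag_mx (v - const_mx a)).
  have P_full : row_full P by rewrite row_full_unit.
  have P_free : row_free P by rewrite row_free_unit.
  rewrite -(eqmxMfull _ P_full) -(mxrankMfree (diag_mx _) P_free).
  by rewrite [diag_mx _]linearB /= diag_const_mx mulmxBl mulmxBr PA mul_mx_scalar mul_scalar_mx.
rewrite mxrank_ker rank_shift rank_diag_mx -[X in (X - _)%N](card_ord d).
rewrite -[X in (X - _)%N](cardC [pred i | v 0 i == a]).
rewrite [X in (_ - X)%N](@eq_card _ _ [predC [pred i | v 0 i == a]]); last first.
  by move=> i; rewrite !inE !mxE subr_eq0.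
by rewrite addnK cardE size_filter enumT; apply: eq_count => i; rewrite !inE.
Qed.

(** * Triangular action on a filtration *)

(** A acts as the scalar theta j on the j-th quotient of a filtration
    0 = W 0, W 1, ..., W m of the full space.  The subspaces are row spaces,
    and matrices act on the right. *)
Section Filtration.

Variables (F : fieldType) (d m : nat) (A : 'M[F]_d).
Variables (theta : nat -> F) (W : nat -> 'M[F]_d).
Hypothesis W0 : W 0 = 0.
Hypothesis W_full : row_full (W m).
Hypothesis W_tri : forall j, (j < m)%N ->
  (W j.+1 *m (A - (theta j)%:M) <= W j)%MS.

(** On W j.+1, the matrix A - theta j maps into W j; but on eigenvectors for a
    it is multiplication by a - theta j, which can be inverted as long as
    theta j differs from a. *)
Lemma eigenvector_descent (p : nat) (U : 'M[F]_(p, d)) (a : F) (l j : nat) :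
    (l <= j <= m)%N -> U *m A = a *: U ->
    (forall i, (l <= i < j)%N -> theta i != a) ->
  (U <= W j)%MS -> (U <= W l)%MS.
Proof.
move=> /andP[le_lj le_jm] UA neq_a; elim: j le_lj le_jm neq_a => [|j IHj].
  by rewrite leqn0 => /eqP->.
rewrite leq_eqVlt => /predU1P[-> //|le_lj] lt_jm neq_a UWj.
apply: IHj => //; first exact: ltnW.
  by move=> i /andP[le_li lt_ij]; apply: neq_a; rewrite le_li ltnW.
have neq_aj : a - theta j != 0 by rewrite subr_eq0 eq_sym neq_a // -ltnS le_lj /=.
have <- : (a - theta j)^-1 *: (U *m (A - (theta j)%:M)) = U.
  by rewrite mulmxBr UA mul_mx_scalar -scalerBl scalerA mulVf // scale1r.
by rewrite scalemx_sub // (submx_trans (submxMr _ UWj)) // W_tri.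
Qed.

(** An eigenvector for any other value would descend from W m to W 0 = 0. *)
Lemma eigenvalue_filtration (a : F) :
  eigenvalue A a -> exists2 j, (j < m)%N & a = theta j.
Proof.
move=> /eigenvalueP[v vA v0].
case: (pickP (fun j : 'I_m => theta j == a)) => [j /eqP <-|neq_a].
  by exists j.
case/eqP: v0; apply/eqP; rewrite -submx0 -W0.
apply: (@eigenvector_descent _ _ a 0 m).
- by rewrite leqnn.
- exact: vA.
- by move=> i lt_im; rewrite (neq_a (Ordinal lt_im)).
- exact: submx_full.
Qed.

Hypothesis W_mono : forall j, (j < m)%N -> (W j <= W j.+1)%MS.
Hypothesis theta_inj : {in gtn m &, injective theta}.

(** Below W j.+1, the value theta j does not occur, so that its eigenvectors
    in W j descend to 0. *)
Lemma filtration_eigenspace_disjoint (j : nat) : (j < m)%N ->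
  (W j :&: eigenspace A (theta j) = 0)%MS.
Proof.
move=> lt_jm; apply/eqP; rewrite -submx0 -W0.
apply: (@eigenvector_descent _ _ (theta j) 0 j).
- by rewrite leq0n ltnW.
- by apply/eigenspaceP; rewrite capmxSr.
- move=> i /= lt_ij; apply/eqP => /theta_inj eq_ij.
  move: (lt_ij); rewrite eq_ij ?ltnn //; exact: ltn_trans lt_ij lt_jm.
- exact: capmxSl.
Qed.

(** The eigenspace lies in W j.+1 by descent from W m, and it is disjoint from
    W j; conversely, A - theta j maps W j.+1 into W j with a kernel inside the
    eigenspace, so that there is no room for anything else. *)
Lemma filtration_step (j : nat) : (j < m)%N ->
  (W j.+1 :=: W j + eigenspace A (theta j))%MS.
Proof.
move=> lt_jm; set E := eigenspace A _.
have sEW : (E <= W j.+1)%MS.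
  apply: (@eigenvector_descent _ _ (theta j) j.+1 m).
  - by rewrite lt_jm leqnn.
  - exact/eigenspaceP.
  - move=> i /andP[lt_ji lt_im]; apply/eqP => /theta_inj eq_ij.
    by move: (lt_ji); rewrite eq_ij ?ltnn.
  - exact: submx_full.
have sWE : (W j + E <= W j.+1)%MS by rewrite addsmx_sub W_mono.
apply/eqmxP; rewrite sWE andbT -(geq_leqif (mxrank_leqif_sup sWE)).
rewrite mxrank_disjoint_sum ?filtration_eigenspace_disjoint //.
rewrite -(mxrank_mul_ker (W j.+1) (A - (theta j)%:M)) leq_add //.
  exact: mxrankS (W_tri lt_jm).
exact: mxrankS (capmxSr _ _).
Qed.

Lemma rank_filtration_step (j : nat) : (j < m)%N ->
  \rank (W j.+1) = (\rank (W j) + \rank (eigenspace A (theta j)))%N.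
Proof.
move=> lt_jm; rewrite filtration_step //.
by rewrite mxrank_disjoint_sum ?filtration_eigenspace_disjoint.
Qed.

Lemma filtration_diagonalizable : diagonalizable A.
Proof.
have W_sum j : (j <= m)%N ->
    (W j <= \sum_(r <- [seq theta i | i <- iota 0 j]) eigenspace A r)%MS.
  elim: j => [|j IHj] lt_jm; first by rewrite W0 sub0mx.
  rewrite filtration_step // -addn1 iotaD map_cat big_cat /= big_seq1.
  by rewrite addsmxS // IHj // ltnW.
apply/diagonalizablePeigen; exists [seq theta i | i <- iota 0 m].
  rewrite map_inj_in_uniq ?iota_uniq // => i j.
  by rewrite !mem_iota !add0n => /theta_inj; apply.
apply/eqmxP; rewrite submx1 sub1mx /=.
by rewrite -sub1mx (submx_trans _ (W_sum m _)) // sub1mx.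
Qed.

End Filtration.

(** * Inclusion and disjointness matrices *)

(** The bound on #|A| excludes a truncated k - #|A|, for which the binomial
    coefficient would be 1. *)
Lemma card_subset_interval (T : finType) (A B : {set T}) (k : nat) :
    A \subset B -> (#|A| <= k)%N ->
  #|[set X : {set T} | (A \subset X) && (X \subset B) & #|X| == k]|
    = 'C(#|B| - #|A|, k - #|A|).
Proof.
move=> sAB le_Ak; rewrite -cardsDS // -cards_draws.
rewrite -[RHS](@card_in_imset _ _ (fun X => A :|: X)); last first.
  move=> X Y; rewrite !inE !subsetD => /andP[/andP[_ dXA] _].
  move=> /andP[/andP[_ dYA] _] /(congr1 (fun Z => Z :\: A)).
  by rewrite !setDUl setDv !set0U !(setDidPl _).
apply: eq_card => X; rewrite inE; apply/idP/imsetP.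
  case/andP=> /andP[sAX sXB] /eqP cX; exists (X :\: A).
    by rewrite inE setSD //= cardsDS // cX.
  by rewrite setUC setDE setUIl [~: A :|: A]setUC setUCr setIT; apply/esym/setUidPl.
case=> Y; rewrite inE subsetD => /andP[/andP[sYB dYA] /eqP cY] ->.
rewrite subsetUl subUset sAB sYB /= cardsU cY.
rewrite (eqP (_ : A :&: Y == set0)) ?cards0 ?subn0 ?subnKC //.
by rewrite setI_eq0 disjoint_sym.
Qed.

Section SubsetMatrices.

Variables (F : fieldType) (T : finType).

Definition ksubset (k : nat) : finType := {A : {set T} | #|A| == k}.

Definition kset (k : nat) (a : 'I_#|ksubset k|) : {set T} :=
  val (enum_val a : ksubset k).

(** Its rows are the functions f_R, for the j-subsets R; they span W_j. *)
Definition incl_mx (j k : nat) : 'M[F]_(#|ksubset j|, #|ksubset k|) :=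
  \matrix_(a, b) (kset a \subset kset b)%:R.

Definition disj_mx (j k : nat) : 'M[F]_(#|ksubset j|, #|ksubset k|) :=
  \matrix_(a, b) [disjoint kset a & kset b]%:R.

Lemma kset_inj (k : nat) : injective (@kset k).
Proof. by move=> a b /val_inj /enum_val_inj. Qed.

Lemma card_kset (k : nat) (a : 'I_#|ksubset k|) :
  #|kset a| = k.
Proof. exact/eqP/(valP (enum_val a : ksubset k)). Qed.

Lemma card_ksubset (k : nat) : #|ksubset k| = 'C(#|T|, k).
Proof. by rewrite card_sig -card_draws; apply: eq_card => A; rewrite !inE. Qed.

Lemma sum_ksubset (k : nat) (P : pred {set T}) :
  \sum_(a < #|ksubset k|) (P (kset a))%:R
    = #|[set A | P A & #|A| == k]|%:R :> F.
Proof.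
rewrite -natr_sum; congr _%:R.
transitivity #|[set a : 'I_#|ksubset k| | P (kset a)]|.
  by rewrite -sum1dep_card [RHS]big_mkcond; apply: eq_bigr => a _; case: (P _).
rewrite -(card_imset _ (@kset_inj k)); apply: eq_card => A; rewrite inE.
apply/imsetP/andP => [[a]|[PA cA]].
  by rewrite inE => Pa ->; rewrite card_kset.
exists (enum_rank (Sub A cA : ksubset k)); last by rewrite /kset enum_rankK SubK.
by rewrite inE /kset enum_rankK SubK.
Qed.

(** Counts the j-subsets between two given sets.  In characteristic 0, this
    places the row space of incl_mx i k inside that of incl_mx j k. *)
Lemma mul_incl_mx (i j k : nat) : (i <= j <= k)%N ->
  incl_mx i j *m incl_mx j k = 'C(k - i, j - i)%:R *: incl_mx i k.
Proof.
move=> /andP[le_ij le_jk]; apply/matrixP => a b; rewrite !mxE.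
pose A := kset a; pose B := kset b.
under eq_bigr do rewrite !mxE -natrM mulnb.
rewrite (sum_ksubset j (fun X => (A \subset X) && (X \subset B))) -/A -/B.
have [sAB|nsAB] := boolP (A \subset B).
  by rewrite card_subset_interval // !card_kset // mulr1.
rewrite mulr0; apply/eqP; rewrite (_ : [set _ | _] = set0) ?cards0 //.
apply/setP => X; rewrite !inE; apply: contraNF nsAB.
by case/andP=> /andP[sAX sXB] _; apply: subset_trans sXB.
Qed.

(** Counts the l-subsets that contain A and avoid B: there are none when A and
    B meet, and their number depends only on the sizes otherwise.  With l = k
    this computes the action of the Kneser matrix on W_j; with k = j it
    relates the rank of incl_mx j l to that of disj_mx j j. *)
Lemma mul_incl_disj_mx (j k l : nat) : (j <= l)%N ->
  incl_mx j l *m disj_mx l k = 'C(#|T| - k - j, l - j)%:R *: disj_mx j k.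
Proof.
move=> le_jl; apply/matrixP => a b; rewrite !mxE.
pose A := kset a; pose B := kset b.
under eq_bigr do rewrite !mxE -natrM mulnb disjoints_subset.
rewrite (sum_ksubset l (fun X => (A \subset X) && (X \subset ~: B))).
rewrite disjoints_subset -/A -/B.
have [sAB|nsAB] := boolP (A \subset ~: B).
  by rewrite card_subset_interval ?card_kset // [#|~: B|]cardsCs setCK card_kset mulr1.
rewrite mulr0; apply/eqP; rewrite (_ : [set _ | _] = set0) ?cards0 //.
apply/setP => X; rewrite !inE; apply: contraNF nsAB.
by case/andP=> /andP[sAX sXB] _; apply: subset_trans sXB.
Qed.

(** Inclusion-exclusion: A and B have 'C(m, i) common i-subsets, where m is
    the size of their intersection, and the alternating sum of these numbers
    is (1 - 1)^m. *)
Lemma disj_mx_sum_incl (j k : nat) :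
  disj_mx j k = \sum_(i < j.+1) (-1) ^+ i *: ((incl_mx i j)^T *m incl_mx i k).
Proof.
apply/matrixP => a b; rewrite summxE !mxE.
pose A := kset a; pose B := kset b.
have term i : ((-1) ^+ i *: ((incl_mx i j)^T *m incl_mx i k)) a b
    = (-1) ^+ i *+ 'C(#|A :&: B|, i).
  rewrite !mxE; under eq_bigr do rewrite !mxE -natrM mulnb -subsetI.
  rewrite (sum_ksubset i (fun X => X \subset A :&: B)) cards_draws.
  by rewrite mulr_natr.
under eq_bigr do rewrite term.
have le_j : (#|A :&: B| <= j)%N.
  by rewrite -[j](card_kset a) subset_leq_card ?subsetIl.
rewrite -/A -/B -setI_eq0 -cards_eq0.
transitivity ((1 - 1 : F) ^+ #|A :&: B|); first by rewrite subrr expr0n.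
rewrite exprDn -(big_mkord xpredT (fun i => (-1) ^+ i *+ 'C(#|A :&: B|, i))).
rewrite (@big_cat_nat _ _ _ #|A :&: B|.+1) //= [X in _ + X]big_nat_cond.
rewrite [X in _ + X]big1 ?addr0; last first.
  by move=> i /andP[/andP[lt_i _] _]; rewrite bin_small.
by rewrite big_mkord; apply: eq_bigr => i _; rewrite expr1n mul1r.
Qed.

Lemma incl_mx_id (k : nat) : incl_mx k k = 1%:M.
Proof.
apply/matrixP => a b; rewrite !mxE; congr (nat_of_bool _)%:R.
rewrite -(inj_eq (@kset_inj k)).
by rewrite [RHS]eqEcard !card_kset leqnn andbT.
Qed.

(** * The spectrum of Kneser graphs *)

Hypothesis charF0 : [pchar F] =i pred0.

Lemma natr_bin_neq0 (p q : nat) : (q <= p)%N -> 'C(p, q)%:R != 0 :> F.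
Proof. by move=> le_qp; rewrite (pcharf0P _).1 // -lt0n bin_gt0. Qed.

Lemma incl_mxS (i j k : nat) : (i <= j <= k)%N ->
  (incl_mx i k <= incl_mx j k)%MS.
Proof.
move=> le_ijk; have C0 : 'C(k - i, j - i)%:R != 0 :> F.
  by rewrite natr_bin_neq0 // leq_sub2r //; case/andP: le_ijk.
rewrite -(eqmx_scale _ C0) -mul_incl_mx //; exact: submxMl.
Qed.

Definition kneser_eigenvalue (k j : nat) : F :=
  (-1) ^+ j * 'C(#|T| - k - j, k - j)%:R.

(** Shifted by one, so that index 0 is the zero space and the row space of
    incl_mx j k has index j.+1. *)
Definition kneser_filtration (k j : nat) : 'M[F]_#|ksubset k| :=
  if j is i.+1 then <<incl_mx i k>>%MS else 0.

Lemma kneser_filtration_full (k : nat) : row_full (kneser_filtration k k.+1).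
Proof. by rewrite -sub1mx /= genmxE incl_mx_id. Qed.

Lemma kneser_filtration_mono (k j : nat) : (j < k.+1)%N ->
  (kneser_filtration k j <= kneser_filtration k j.+1)%MS.
Proof.
case: j => [|j] lt_jk; first exact: sub0mx.
by rewrite /= !genmxE incl_mxS // leqnSn.
Qed.

(** Multiplying the inclusion matrix by disj_mx k k gives a multiple of
    disj_mx j k, whose inclusion-exclusion expansion has one term outside the
    previous subspace: the one of index j, a multiple of incl_mx j k. *)
Lemma kneser_filtration_tri (k j : nat) : (j < k.+1)%N ->
  (kneser_filtration k j.+1 *m (disj_mx k k - (kneser_eigenvalue k j)%:M)
     <= kneser_filtration k j)%MS.
Proof.
rewrite ltnS => le_jk; rewrite (eqmxMr _ (genmxE _)) mulmxBr mul_incl_disj_mx //.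
rewrite mul_mx_scalar disj_mx_sum_incl big_ord_recr /= incl_mx_id trmx1 mul1mx.
rewrite scalerDr scalerA [X in X *: incl_mx j k]mulrC addrK scalemx_sub //.
case: j le_jk => [|j] lt_jk; first by rewrite big_ord0 sub0mx.
apply: summx_sub => i _; rewrite /= genmxE scalemx_sub //.
by rewrite (submx_trans (submxMl _ _)) // incl_mxS // -ltnS ltn_ord ltnW.
Qed.

Lemma eigenvalue_kneser (k : nat) (a : F) :
  eigenvalue (disj_mx k k) a -> exists2 j, (j <= k)%N & a = kneser_eigenvalue k j.
Proof.
move=> /(eigenvalue_filtration (W := kneser_filtration k) (erefl _)
  (kneser_filtration_full k) (@kneser_filtration_tri k))[j lt_jk ->].
by exists j.
Qed.

(** Every eigenvalue is, up to sign, a binomial coefficient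
    'C(#|T| - k - j, k - j), whose arguments are in the right order because
    2 k <= #|T|. *)
Lemma disj_mx_row_free (k : nat) : (k + k <= #|T|)%N -> row_free (disj_mx k k).
Proof.
move=> le_kT; rewrite -kermx_eq0; apply: contraT => ker0.
have /eigenvalue_kneser[j le_jk /esym/eqP] : eigenvalue (disj_mx k k) 0.
  by rewrite /eigenvalue /eigenspace raddf0 subr0.
rewrite mulf_eq0 signr_eq0 (negPf (natr_bin_neq0 _)) //.
by rewrite -subnDA leq_subRL; lia.
Qed.

(** A right inverse comes from the invertible disj_mx j j, of which
    incl_mx j k *m disj_mx k j is a nonzero multiple. *)
Lemma incl_mx_row_free (j k : nat) :
  (j <= k)%N -> (j + k <= #|T|)%N -> row_free (incl_mx j k).
Proof.
move=> le_jk le_T.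
have C0 : 'C(#|T| - j - j, k - j)%:R != 0 :> F by rewrite natr_bin_neq0 //; lia.
have /row_freeP[B dB1] : row_free (disj_mx j j) by rewrite disj_mx_row_free //; lia.
apply/row_freeP; exists (disj_mx k j *m ('C(#|T| - j - j, k - j)%:R^-1 *: B)).
by rewrite mulmxA mul_incl_disj_mx // -scalemxAr -scalemxAl dB1 scalerA mulVf ?scale1r.
Qed.

Lemma rank_kneser_filtration (k j : nat) : (k + k <= #|T|)%N -> (j <= k)%N ->
  \rank (kneser_filtration k j.+1) = 'C(#|T|, j).
Proof.
move=> le_kT le_jk; rewrite genmxE -card_ksubset; apply/eqP.
by apply: incl_mx_row_free => //; lia.
Qed.

End SubsetMatrices.

(** * The odd graph *)

(** The binomial coefficients sit in the right half of row 2 n + 1, where the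
    vanishing of the entries above the diagonal of the triangle is that of
    'C(p, q) for q > p.  The missing entry of index -1 is 0 by the symmetry of
    the row about its middle, which is the case k = 0 of the induction. *)
Lemma catalan_triangle_bin (n k : nat) :
  (catalan_triangle n k + 'C(2 * n + 1, n + k + 2) = 'C(2 * n + 1, n + k + 1))%N.
Proof.
elim: n k => [|n IHn] k; first by case: k => [|k]; rewrite // !bin_small //; lia.
have binSS p q : 'C(p.+2, q.+2) = ('C(p, q.+2) + 2 * 'C(p, q.+1) + 'C(p, q))%N.
  by rewrite !binS; lia.
have -> : (2 * n.+1 + 1 = (2 * n + 1).+2)%N by lia.
have -> : (n.+1 + k + 2 = (n + k + 1).+2)%N by lia.
have -> : (n.+1 + k + 1 = (n + k).+2)%N by lia.
rewrite !binSS /=.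
have := IHn k.+1; have := IHn k.
rewrite !addn2 !addn1 !addnS.
case: k => [|k].
  have : 'C((2 * n).+1, n) = 'C((2 * n).+1, n.+1).
    by rewrite -bin_sub; [congr 'C(_, _)|]; lia.
  rewrite !addn0; lia.
have := IHn k; rewrite !addn2 !addn1 !addnS; lia.
Qed.

Lemma catalan_triangle_binB (n i : nat) : (1 <= i <= n)%N ->
  (catalan_triangle (n - 1) (i - 1) + 'C(2 * n - 1, n + i) = 'C(2 * n - 1, n - i))%N.
Proof.
case: i => // i lt_in; have le_in : (n - i.+1 <= 2 * n - 1)%N by lia.
rewrite -(bin_sub le_in).
have -> : (2 * n - 1 - (n - i.+1) = n - 1 + (i.+1 - 1) + 1)%N by lia.
have -> : (n + i.+1 = n - 1 + (i.+1 - 1) + 2)%N by lia.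
have -> : (2 * n - 1 = 2 * (n - 1) + 1)%N by lia.
exact: catalan_triangle_bin.
Qed.

Lemma catalan_triangle_gt0 (n k : nat) : (k <= n)%N -> (0 < catalan_triangle n k)%N.
Proof.
elim: n k => [|n IHn] [|k] //= le_kn; last by have := IHn k le_kn; lia.
by have := IHn 0%N (leq0n n); lia.
Qed.

Lemma kneser_eigenvalue_odd (F : fieldType) (n i : nat) : (1 <= i <= n)%N ->
  kneser_eigenvalue F 'I_(2 * n - 1) (n - 1) (n - i) = odd_lambda F n i.
Proof.
move=> /andP[i_gt0 le_in]; rewrite /kneser_eigenvalue /odd_lambda card_ord.
have -> : (2 * n - 1 - (n - 1) - (n - i) = (i.-1).+1)%N by lia.
have -> : (n - 1 - (n - i) = i.-1)%N by lia.
rewrite binSn prednK // -signr_odd -[in RHS]signr_odd.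
by congr ((-1) ^+ nat_of_bool _ * _); lia.
Qed.

Lemma natr_inj_pchar0 (F : fieldType) :
  [pchar F] =i pred0 -> injective (fun i : nat => i%:R : F).
Proof.
move=> charF0 i j; wlog le_ij : i j / (i <= j)%N => [IH eq_ij|/esym/eqP].
  by case/orP: (leq_total i j) => /IH; [apply | move=> /(_ (esym eq_ij))].
rewrite -subr_eq0 -natrB // (pcharf0P _).1 // subn_eq0 => le_ji.
by apply/eqP; rewrite eqn_leq le_ij.
Qed.

(** Squaring removes the signs. *)
Lemma odd_lambda_inj (F : fieldType) (n : nat) :
  [pchar F] =i pred0 -> injective (odd_lambda F n).
Proof.
move=> charF0 i j /(congr1 (fun x => x ^+ 2)).
rewrite /odd_lambda !exprMn !sqrr_sign !mul1r -!natrX.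
by move=> /(natr_inj_pchar0 charF0)/eqP; rewrite eqn_exp2r // => /eqP.
Qed.

Theorem lemma4p2 (F : fieldType) (charF0 : [pchar F] =i pred0)
    (n : nat) (n_ge2 : (2 <= n)%N) :
  (forall a : F, eigenvalue (odd_adj F n) a <->
     exists i : nat, (1 <= i <= n)%N /\ a = odd_lambda F n i) /\
  (forall i : nat, (1 <= i <= n)%N ->
     mup (odd_lambda F n i) (char_poly (odd_adj F n))
       = catalan_triangle (n - 1) (i - 1) /\
     \rank (eigenspace (odd_adj F n) (odd_lambda F n i))
       = catalan_triangle (n - 1) (i - 1)).
Proof.
(* Index j of the filtration corresponds to i = n - j. *)
set A := odd_adj F n; set k := (n - 1)%N.
pose W := kneser_filtration F 'I_(2 * n - 1) k.
pose theta j := odd_lambda F n (n - j).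
have thetaE j : (j < k.+1)%N -> kneser_eigenvalue F 'I_(2 * n - 1) k j = theta j.
  by move=> lt_jk; rewrite /theta -kneser_eigenvalue_odd ?subKn //; lia.
have W_tri j : (j < k.+1)%N -> (W j.+1 *m (A - (theta j)%:M) <= W j)%MS.
  by move=> lt_jk; rewrite -thetaE // kneser_filtration_tri.
have W_mono j : (j < k.+1)%N -> (W j <= W j.+1)%MS.
  exact: kneser_filtration_mono.
have theta_inj : {in gtn k.+1 &, injective theta}.
  by move=> i j; rewrite !inE => lt_ik lt_jk /(odd_lambda_inj charF0); lia.
have W_full : row_full (W k.+1) by exact: kneser_filtration_full.
have rankW j : (j <= k)%N -> \rank (W j.+1) = 'C(2 * n - 1, j).
  by move=> le_jk; rewrite rank_kneser_filtration ?card_ord //; lia.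
have rankE i : (1 <= i <= n)%N ->
    \rank (eigenspace A (odd_lambda F n i)) = catalan_triangle (n - 1) (i - 1).
  move=> i_bounds; have lt_jk : (n - i < k.+1)%N by lia.
  have := rank_filtration_step (erefl (W 0)) W_full W_tri W_mono theta_inj lt_jk.
  rewrite /theta subKn ?rankW //; last by lia.
  have := catalan_triangle_binB i_bounds.
  have -> : \rank (W (n - i)%N) = 'C(2 * n - 1, n + i).
    case def_j : (n - i)%N => [|j]; first by rewrite mxrank0 bin_small //; lia.
    rewrite rankW; last by lia.
    by rewrite -(@bin_sub _ j); [congr binomial|]; lia.
  by move=> <-; rewrite addnC => /addnI.
split=> [a|i i_bounds]; last first.
  split; last exact: rankE.
  rewrite mup_char_poly_diagonalizable ?rankE //.
  exact: filtration_diagonalizable (erefl (W 0)) W_full W_tri W_mono theta_inj.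
split=> [/eigenvalue_kneser[//|j le_jk ->]|[i [i_bounds ->]]].
  by exists (n - j)%N; rewrite thetaE //; split=> //; lia.
rewrite /eigenvalue -mxrank_eq0 rankE // -lt0n catalan_triangle_gt0 //; lia.
Qed.
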